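(* Let $C'\ge 2$ and $m\ge 1$ be integers, let $f:\mathcal X\to\mathbb R^d$ be a fixed feature map and $D_1,\dots,D_{C'}$ class-conditional distributions on $\mathcal X$, under the standing assumptions in the context. Then \[ \mathrm{err}^{\mathrm{NCC}}_{m}(f)\le \frac{1}{C'}\sum_{i=1}^{C'}\sum_{j\neq i}\frac{4\tilde V_{ij}+\frac{12}{m}V_{ij}^2+\frac{6}{m}V_{ij}}{\bigl(1+\frac{v_j-v_i}{m d_{ij}^2}\bigr)^2}+\frac{1}{C'}\sum_{i=1}^{C'}\sum_{j\neq i}\frac{\frac{3}{m^3}\bigl(\Theta_{ij}+2(m-1)V_{ij}^2\bigr)}{\bigl(1+\frac{v_j-v_i}{m d_{ij}^2}\bigr)^2}. \]
   Context: Setup (nearest-class-centroid few-shot classification). Fix $f:\mathcal X\to\mathbb R^d$ and distributions $D_1,\dots,D_{C'}$ on $\mathcal X$. For a class $c$, let $z_c=f(x)$ with $x\sim D_c$, $\mu_c:=\mathbb E[z_c]$, $\Sigma_c:=\mathrm{Cov}(z_c)$, $v_c:=\mathrm{tr}(\Sigma_c)$, and $M_{4,c}:=\mathbb E\|z_c-\mu_c\|_2^4$, assumed finite. For each class $c$ draw a support set $x_{c,1},\dots,x_{c,m}$ i.i.d. from $D_c$, independently across classes; let $\widehat\mu_c:=\frac1m\sum_{s=1}^m f(x_{c,s})$. NCC predicts $\widehat y(z)\in\arg\min_c\|z-\widehat\mu_c\|_2^2$ with a fixed tie-breaking rule; $\mathrm{err}^{\mathrm{NCC}}_m(f):=\frac1{C'}\sum_{i}\Pr(\widehat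 y(z_i)\neq i)$ with $z_i=f(x_i)$, $x_i\sim D_i$ independent of the support sets. For $i\neq j$: $d_{ij}:=\|\mu_j-\mu_i\|_2>0$, $u_{ij}:=(\mu_j-\mu_i)/d_{ij}$, $\tilde V_{ij}:=\frac{u_{ij}^\top\Sigma_iu_{ij}}{d_{ij}^2}$, $V_{ij}:=\frac{v_i+v_j}{d_{ij}^2}$, $\Theta_{ij}:=\frac{M_{4,i}+M_{4,j}}{d_{ij}^4}$. It is assumed that $d_{ij}^2+\frac{v_j-v_i}{m}>0$ for all $i\ne j$. *)

(* Defs.v *)
From HB Require Import structures.
From mathcomp Require Import all_boot all_order all_algebra.
From mathcomp Require Import all_classical all_reals all_analysis.
Set Implicit Arguments. Unset Strict Implicit. Unset Printing Implicit Defensive.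
Import Order.TTheory GRing.Theory Num.Theory.
Import numFieldNormedType.Exports.
Local Open Scope classical_set_scope.
Local Open Scope ring_scope.

Definition sqnorm (R : realType) (d : nat) (v : 'rV[R]_d) : R :=
  \sum_(k < d) (v 0 k) ^+ 2.

Section Features.
Context (R : realType) (dX : measure_display) (X : measurableType dX) (d : nat).
Variables (D : probability X R) (f : X -> 'rV[R]_d).

Definition feat_mean : 'rV[R]_d := \row_(k < d) \int[D]_(x in setT) (f x 0 k).

Definition feat_cov : 'M[R]_d := \matrix_(k < d, l < d)
  \int[D]_(x in setT) ((f x 0 k - feat_mean 0 k) * (f x 0 l - feat_mean 0 l)).

Definition feat_tvar : R := \tr feat_cov.

Definition feat_M4 : R := \int[D]_(x in setT) (sqnorm (f x - feat_mean) ^+ 2).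
End Features.

Section Pairwise.
Context (R : realType) (dX : measure_display) (X : measurableType dX) (d C : nat).
Variables (D : 'I_C -> probability X R) (f : X -> 'rV[R]_d).

Definition mu_ (c : 'I_C) := feat_mean (D c) f.
Definition dist_ (i j : 'I_C) : R := Num.sqrt (sqnorm (mu_ j - mu_ i)).
Definition u_ (i j : 'I_C) : 'rV[R]_d := (dist_ i j)^-1 *: (mu_ j - mu_ i).
Definition Vt_ (i j : 'I_C) : R :=
  (u_ i j *m feat_cov (D i) f *m (u_ i j)^T) 0 0 / (dist_ i j ^+ 2).
Definition V_ (i j : 'I_C) : R :=
  (feat_tvar (D i) f + feat_tvar (D j) f) / (dist_ i j ^+ 2).
Definition Theta_ (i j : 'I_C) : R :=
  (feat_M4 (D i) f + feat_M4 (D j) f) / (dist_ i j ^+ 4).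
End Pairwise.

Section Prob.
Context (R : realType) (dO : measure_display) (Omega : measurableType dO)
  (dX : measure_display) (X : measurableType dX).
Variable P : probability Omega R.

Definition has_law (Y : Omega -> X) (D : probability X R) : Prop :=
  measurable_fun setT Y /\
  forall A : set X, measurable A -> P (Y @^-1` A) = D A.

Definition mutually_independent (I : finType) (Y : I -> Omega -> X) : Prop :=
  forall A : I -> set X, (forall k, measurable (A k)) ->
    P (\bigcap_(k in [set: I]) (Y k @^-1` A k)) = (\prod_(k : I) P (Y k @^-1` A k))%E.
End Prob.

(* a nearest-class-centroid predictor with some fixed tie-breaking rule:
   pred z mu always returns a minimizer of c |-> || z - mu c ||^2 *)
Definition ncc_rule (R : realType) (d C : nat)
  (pred : 'rV[R]_d -> ('I_C -> 'rV[R]_d) -> 'I_C) : Prop :=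
  forall z mu (c : 'I_C), sqnorm (z - mu (pred z mu)) <= sqnorm (z - mu c).

Definition emp_centroids (R : realType) (T X : Type) (d C m : nat)
  (f : X -> 'rV[R]_d) (xs : 'I_C -> 'I_m -> T -> X) (w : T) : 'I_C -> 'rV[R]_d :=
  fun c => (m%:R)^-1 *: \sum_(s < m) f (xs c s w).

Definition ncc_err_event (R : realType) (T X : Type) (d C m : nat)
  (pred : 'rV[R]_d -> ('I_C -> 'rV[R]_d) -> 'I_C)
  (f : X -> 'rV[R]_d) (xs : 'I_C -> 'I_m -> T -> X) (xt : 'I_C -> T -> X)
  (i : 'I_C) : set T :=
  [set w | pred (f (xt i w)) (emp_centroids f xs w) != i].

Definition ncc_err (R : realType) (dO : measure_display) (Omega : measurableType dO)
  (P : probability Omega R) (X : Type) (d C m : nat)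
  (pred : 'rV[R]_d -> ('I_C -> 'rV[R]_d) -> 'I_C)
  (f : X -> 'rV[R]_d) (xs : 'I_C -> 'I_m -> Omega -> X) (xt : 'I_C -> Omega -> X) : R :=
  (C%:R)^-1 * \sum_(i < C) fine (P (ncc_err_event pred f xs xt i)).

Definition test_and_support (T X : Type) (C m : nat)
  (xs : 'I_C -> 'I_m -> T -> X) (xt : 'I_C -> T -> X) (i : 'I_C)
  : option ('I_C * 'I_m) -> T -> X :=
  fun k => match k with None => xt i | Some cs => xs cs.1 cs.2 end.

(* Main.v *)
(* Fix classes i <> j and let T be the margin |z - muhat_j|^2 - |z - muhat_i|^2 of
   a test point z of class i.  Both residuals are linear combinations of the
   independent vectors f(Y_k), where k ranges over the test point and the support
   points.  Centering g_k = f(Y_k) - E f(Y_k) gives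
     T - E T = sum_k phi_k + sum_(k <> l) q_kl <g_k, g_l>,
   with phi_k mean-zero and depending on Y_k alone.  The one-sample terms and the
   interactions over distinct pairs {k, l} are pairwise orthogonal, so that
     Var T <= sum_k E phi_k^2 + 2 sum_(k <> l) q_kl^2 tr Sigma_k tr Sigma_l,
   and Var T / (E T)^2 is at most the (i, j) term of the claimed bound.  An error
   on class i forces T <= 0 for some j, hence 1 <= sum_j (T_j - E T_j)^2 / (E T_j)^2. *)
Require Import Defs.
From HB Require Import structures.
From mathcomp Require Import all_boot all_order all_algebra.
From mathcomp Require Import all_classical all_reals all_analysis.
From mathcomp Require Import measurable_realfun ring lra.
Import Order.TTheory GRing.Theory Num.Theory.
Import numFieldNormedType.Exports.
Import HBNNSimple.
Local Open Scope classical_set_scope.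
Local Open Scope ring_scope.

(** * Expectation of products of independent samples *)

Section Independence.
Context {R : realType} {dX : measure_display} {X : measurableType dX}
  {dO : measure_display} {Omega : measurableType dO} {P : probability Omega R}.

(** Passage from indicators to nonnegative functions: both sides are additive over the values of a
    simple function and continuous under increasing limits. In the application [W] is the product of
    the factors carried by the other samples and [c] its expectation. *)
Lemma ge0_integral_weighted_law (Y : Omega -> X) (D : probability X R)
    (W : Omega -> R) (c : R) (h : X -> R) :
  measurable_fun setT Y -> measurable_fun setT W -> (forall w, 0 <= W w) ->
  (forall A, measurable A ->
     (\int[P]_w (\1_A (Y w) * W w)%:E = D A * c%:E)%E) ->
  measurable_fun setT h -> (forall x, 0 <= h x) ->
  (\int[P]_w (h (Y w) * W w)%:E = (\int[D]_x (h x)%:E) * c%:E)%E.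
Proof.
move=> mY mW W0 HA mh h0.
have hE0 x : setT x -> (0 <= (EFin \o h) x)%E by rewrite lee_fin.
have [g [gnd gcv]] :=
  approximation measurableT ((measurable_EFinP setT h).2 mh) hE0.
have mgY n : measurable_fun setT (fun w => g n (Y w)).
  exact: (measurableT_comp _ mY).
have mgW n : measurable_fun setT (fun w => g n (Y w) * W w).
  exact: measurable_funM.
have Hn n : (\int[P]_w (g n (Y w) * W w)%:E =
    (\int[D]_x (g n x)%:E) * c%:E)%E.
  pose F (y : R) := g n @^-1` [set y].
  have mF y : measurable (F y) by exact: measurable_sfunP.
  (* A negative [y] has an empty fibre under the nonnegative [g n], so nonnegativity holds for every
     real [y], as the exchange of sum and integral demands. *)
  have F0 y x : 0 <= y * \1_(F y) x :> R.
    have [y0|y0] := leP 0 y; first by rewrite mulr_ge0.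
    rewrite /F preimage_nnfun0// indic0 mulr0//.
  transitivity (\int[P]_w (\sum_(y \in range (g n)) (y * \1_(F y) (Y w) * W w)%:E))%E.
    apply: eq_integral => w _; rewrite fimfunE fsumEFin//.
    by rewrite !fsbig_finite ?mulr_suml//=; exact: fimfunP.
  rewrite ge0_integral_fsum//=; last 2 first.
    move=> y; apply/measurable_EFinP; apply: measurable_funM => //.
    apply: measurable_funM => //.
    by apply: (measurableT_comp _ mY); exact: measurable_indic.
    by move=> y w _; rewrite lee_fin mulr_ge0.
  transitivity ((\sum_(y \in range (g n)) (\int[D]_x (y * \1_(F y) x)%:E)) * c%:E)%E;
    last first.
    congr (_ * _)%E; rewrite -ge0_integral_fsum//=; last 2 first.
      by move=> y; apply/measurable_EFinP; apply: measurable_funM.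
      by move=> y x _; rewrite lee_fin.
    apply: eq_integral => x _; rewrite fsumEFin//.
    by rewrite -fimfunE.
  rewrite ge0_mule_fsuml; last first.
    by move=> y; apply: integral_ge0 => x _; rewrite lee_fin.
  apply: eq_fsbigr => y _.
  rewrite integralZl_indic_nnsfun//.
  rewrite integral_indic// setIT -muleA -HA//.
  have [y0|y0] := leP 0 y; last first.
    rewrite /F preimage_nnfun0// integral0_eq ?integral0_eq ?mule0//.
    by move=> w _; rewrite indic0 mul0r.
    by move=> w _; rewrite indic0 mulr0 mul0r.
  rewrite -ge0_integralZl//.
  - by apply: eq_integral => w _; rewrite -EFinM mulrA.
  - apply/measurable_EFinP; apply: measurable_funM => //.
    by apply: (measurableT_comp _ mY); exact: measurable_indic.
  - by move=> w _; rewrite lee_fin mulr_ge0.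
(* Monotone convergence is applied under [P] and then under [D]; the two sequences agree by [Hn],
   hence so do their limits. *)
have L : (\int[P]_w (g n (Y w) * W w)%:E @[n --> \oo] -->
    \int[P]_w (h (Y w) * W w)%:E)%E.
  have -> : (\int[P]_w (h (Y w) * W w)%:E =
      \int[P]_w limn (fun n => (g n (Y w) * W w)%:E))%E.
    apply: eq_integral => w _; apply/esym/cvg_lim => //.
    by under eq_fun do rewrite EFinM; rewrite EFinM; apply: cvgeZr => //; exact: gcv.
  apply: cvg_monotone_convergence => //.
  - by move=> n; exact/measurable_EFinP.
  - by move=> n w _; rewrite lee_fin mulr_ge0.
  - move=> w _ n k nk; rewrite lee_fin ler_wpM2r//.
    by have /lefP := gnd _ _ nk; apply.
have M : ((\int[D]_x (g n x)%:E) @[n --> \oo] --> \int[D]_x (h x)%:E)%E.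
  have -> : (\int[D]_x (h x)%:E = \int[D]_x limn (fun n => (g n x)%:E))%E.
    by apply: eq_integral => w _; apply/esym/cvg_lim => //; exact: gcv.
  apply: cvg_monotone_convergence => //.
  - by move=> n; exact/measurable_EFinP.
  - by move=> n w _; rewrite lee_fin.
  - move=> w _ n k nk; rewrite lee_fin.
    by have /lefP := gnd _ _ nk; apply.
have M2 := cvgeZr (isT : c%:E \is a fin_num) M.
move: L; under eq_fun do rewrite Hn.
by move/(cvg_unique (@ereal_hausdorff R)) => /(_ _ M2).
Qed.

Context {I : finType} {Y : I -> Omega -> X} {D : I -> probability X R}.
Hypotheses (lawY : forall k, has_law P (Y k) (D k))
  (indY : mutually_independent P Y).

Let mY k : measurable_fun setT (Y k). Proof. by case: (lawY k). Qed.

Let mhY k (h : X -> R) : measurable_fun setT h ->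
  measurable_fun setT (h \o Y k).
Proof. by move=> mh; exact: measurableT_comp. Qed.

Lemma integral_prod_indic (A : I -> set X) : (forall k, measurable (A k)) ->
  (\int[P]_w (\prod_k \1_(A k) (Y k w))%:E =
   (\prod_k \int[D k]_x \1_(A k) x)%:E)%E.
Proof.
move=> mA.
transitivity (\int[P]_w (\1_(\bigcap_(k in [set: I]) (Y k @^-1` A k)) w)%:E)%E.
  apply: eq_integral => w _; congr EFin; rewrite indicE.
  have [wA|wA] := pselect ((\bigcap_(k in [set: I]) (Y k @^-1` A k)) w).
    by rewrite mem_set// big1// => k _; rewrite indicE mem_set//; exact: wA.
  rewrite memNset//; move/existsNP: wA => [k /not_implyP[_ nA]].
  by rewrite (bigD1 k)//= indicE memNset// mul0r.
rewrite integral_indic//; last first.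
  apply: fin_bigcap_measurable => // k _; rewrite -[X in measurable X]setTI.
  exact: mY.
rewrite setIT; transitivity (\prod_(k : I) P (Y k @^-1` A k))%E; first exact: indY.
rewrite -prodEFin; apply: eq_bigr => k _.
have [_ ->//] := lawY k.
rewrite /Rintegral integral_indic// setIT fineK//.
by rewrite fin_num_measure.
Qed.

(** Independence is assumed for events only, so factors are upgraded from indicators to general
    functions one at a time. The induction runs over the list of indices whose factor is not yet
    known to be an indicator; it starts with all of [enum I]. *)
Lemma ge0_integral_prod (h : I -> X -> R) :
  (forall k, (D k).-integrable setT (EFin \o h k)) ->
  (forall k x, 0 <= h k x) ->
  (\int[P]_w (\prod_k h k (Y k w))%:E = (\prod_k \int[D k]_x h k x)%:E)%E.
Proof.
move=> ih h0.
have : forall k, k \notin enum I -> exists2 A, measurable A & h k = \1_A.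
  by move=> k; rewrite mem_enum.
elim: (enum I) h ih h0 => [|k s IH] h ih h0 hs.
  have [A AP] : {A : I -> set X & forall k, measurable (A k) /\ h k = \1_(A k)}.
    apply: (@choice _ _ (fun k A => measurable A /\ h k = \1_A)) => k.
    by have [//|A mA hA] := hs k; exists A.
  have -> : h = fun k => \1_(A k) by apply/funext => k; case: (AP k).
  by apply: integral_prod_indic => k; case: (AP k).
have mh l : measurable_fun setT (h l).
  exact/measurable_EFinP/(measurable_int _ (ih l)).
pose W w := \prod_(l | l != k) h l (Y l w).
pose c := \prod_(l | l != k) \int[D l]_x h l x.
transitivity (\int[P]_w (h k (Y k w) * W w)%:E)%E.
  by apply: eq_integral => w _; rewrite (bigD1 k).
have -> : (\prod_l \int[D l]_x h l x)%:E = (\int[D k]_x (h k x)%:E * c%:E)%E.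
  rewrite (bigD1 k)//= EFinM; congr (_ * _)%E.
  by rewrite /Rintegral fineK//; exact: (integrable_fin_num measurableT (ih k)).
apply: ge0_integral_weighted_law => //.
- rewrite /W; under eq_fun do rewrite big_mkcond/=.
  apply: (@measurable_prod _ _ _ _ _ _ (fun l w => if l != k then h l (Y l w) else 1)).
  by move=> l _; case: (l != k) => //; exact: mhY.
- by move=> w; apply: prodr_ge0.
(* With an indicator at [k], the induction hypothesis applies and supplies the weighted law for the
   remaining factors. *)
move=> A mA; pose h' l := if l == k then \1_A else h l.
have := IH h'; rewrite /h' (bigD1 k)//= eqxx.
have -> : \prod_(l | l != k) \int[D l]_x (if l == k then \1_A else h l) x = c.
  by apply: eq_bigr => l /negPf ->.
have -> : (\int[D k]_x \1_A x * c)%:E = (D k A * c%:E)%E.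
  rewrite EFinM /Rintegral integral_indic// setIT fineK//.
  by rewrite fin_num_measure.
move=> <-.
- apply: eq_integral => w _; rewrite (bigD1 k)//= eqxx; congr (_ * _)%:E.
  by apply: eq_bigr => l /negPf ->.
- by move=> l; case: ifP => _ //; exact: integrable_indic.
- by move=> l x; case: ifP.
- move=> l ls; case: eqP => [_|/eqP lk]; first by exists A.
  by apply: hs; rewrite inE (negPf lk).
Qed.

Lemma integrable_prod (h : I -> X -> R) :
  (forall k, (D k).-integrable setT (EFin \o h k)) ->
  P.-integrable setT (EFin \o (fun w => \prod_k h k (Y k w))).
Proof.
move=> ih.
have mh l : measurable_fun setT (h l).
  exact/measurable_EFinP/(measurable_int _ (ih l)).
apply/integrableP; split.
  apply/measurable_EFinP; apply: measurable_prod => l _; exact: mhY.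
rewrite (_ : (\int[P]_w _)%E = (\int[P]_w (\prod_k `|h k (Y k w)|)%:E)%E).
  rewrite (@ge0_integral_prod (fun k => Num.norm \o h k)) ?ltry//.
      by move=> k; have := integrable_norm (ih k); apply.
  by move=> k x; exact: normr_ge0.
by apply: eq_integral => w _ /=; rewrite normr_prod.
Qed.

(** Same induction, now over the indices whose factor may change sign: the factor at [k] is split
    into its positive and negative parts, and both sides are linear in that factor. *)
Lemma Rintegral_prod (h : I -> X -> R) :
  (forall k, (D k).-integrable setT (EFin \o h k)) ->
  \int[P]_w (\prod_k h k (Y k w)) = \prod_k \int[D k]_x h k x.
Proof.
move=> ih.
have : forall k, k \notin enum I -> forall x, 0 <= h k x.
  by move=> k; rewrite mem_enum.
elim: (enum I) h ih => [|k s IH] h ih hs.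
  by rewrite /Rintegral ge0_integral_prod// => k x; exact: hs.
pose hp l := if l == k then (h k)^\+ else h l.
pose hn l := if l == k then (h k)^\- else h l.
have ip l : (D l).-integrable setT (EFin \o hp l).
  by rewrite /hp; case: eqP => [->|_ //]; exact: (integrable_funrpos measurableT (ih k)).
have in_ l : (D l).-integrable setT (EFin \o hn l).
  by rewrite /hn; case: eqP => [->|_ //]; exact: (integrable_funrneg measurableT (ih k)).
have ep : forall k0, k0 \notin s -> forall x, 0 <= hp k0 x.
  move=> l ls x; rewrite /hp; case: eqP => [_|/eqP lk].
    exact: funrpos_ge0.
  by apply: hs; rewrite inE (negPf lk).
have en : forall k0, k0 \notin s -> forall x, 0 <= hn k0 x.
  move=> l ls x; rewrite /hn; case: eqP => [_|/eqP lk].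
    exact: funrneg_ge0.
  by apply: hs; rewrite inE (negPf lk).
have hkE x : h k x = (h k)^\+ x - (h k)^\- x.
  by have /(congr1 (fun f => f x)) <- := funrposBneg (h k).
transitivity (\int[P]_w (\prod_l hp l (Y l w) - \prod_l hn l (Y l w))).
  apply: eq_Rintegral => w _; rewrite (bigD1 k)//= hkE.
  have e (g : X -> R) : \prod_l (if l == k then g else h l) (Y l w) =
      g (Y k w) * \prod_(i | i != k) h i (Y i w).
    by rewrite (bigD1 k)//= eqxx; congr (_ * _); apply: eq_bigr => l /negPf ->.
  by rewrite /hp /hn !e mulrBl.
have Pp := integrable_prod _ ip; have Pn := integrable_prod _ in_.
rewrite (RintegralB measurableT Pp Pn).
rewrite !IH//.
have e (g : X -> R) : \prod_l \int[D l]_x (if l == k then g else h l) x =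
    \int[D k]_x g x * \prod_(i | i != k) \int[D i]_x h i x.
  by rewrite (bigD1 k)//= eqxx; congr (_ * _); apply: eq_bigr => l /negPf ->.
rewrite /hp /hn !e [RHS](bigD1 k)//= -mulrBl; congr (_ * _).
rewrite -RintegralB//; [|exact: (integrable_funrpos measurableT (ih k))
  |exact: (integrable_funrneg measurableT (ih k))].
by apply: eq_Rintegral => x _; rewrite hkE.
Qed.

End Independence.

(** * Square-integrable functions *)

Lemma Cauchy_Schwarz_sum (R : realDomainType) (I : finType) (x y : I -> R) :
  (\sum_a x a * y a) ^+ 2 <= (\sum_a x a ^+ 2) * (\sum_a y a ^+ 2).
Proof.
(* Lagrange's identity: twice the gap is a double sum of squares. *)
rewrite -subr_ge0 -(pmulrn_lge0 _ (isT : (0 < 2)%N)).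
have -> : ((\sum_a x a ^+ 2) * (\sum_a y a ^+ 2) - (\sum_a x a * y a) ^+ 2) *+ 2 =
    \sum_a \sum_b (x a * y b - x b * y a) ^+ 2.
  transitivity (\sum_a \sum_b (x a ^+ 2 * y b ^+ 2 + x b ^+ 2 * y a ^+ 2
      - (x a * y a) * (x b * y b) *+ 2)); last first.
    by apply: eq_bigr => a _; apply: eq_bigr => b _; ring.
  under [RHS]eq_bigr do rewrite sumrB big_split/=.
  rewrite sumrB big_split/= [X in _ = _ + X - _]exchange_big/=.
  under [X in _ = _ - X]eq_bigr do rewrite sumrMnl.
  by rewrite sumrMnl -!big_distrlr/= expr2 mulrnBl [in LHS]mulr2n.
by apply: sumr_ge0 => a _; apply: sumr_ge0 => b _; exact: sqr_ge0.
Qed.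

Section SquareIntegrable.
Context {R : realType} {dT : measure_display} {T : measurableType dT}
  {mu : probability T R}.
Implicit Types f g : T -> R.

Lemma Lfun2P f : f \in Lfun mu 2%:E <->
  measurable_fun setT f /\ mu.-integrable setT (EFin \o (fun x => f x ^+ 2)).
Proof.
split=> [f2|[mf /integrableP[_ If]]].
  split; last exact: Lfun2_integrable_sqr.
  by move: f2; rewrite inE => /andP[/[!inE]].
rewrite inE; apply/andP; split; rewrite inE//=.
rewrite /finite_norm unlock poweR_lty//.
apply: le_lt_trans If; rewrite le_eqVlt; apply/orP; left; apply/eqP.
by apply: eq_integral => x _ /=; rewrite normrX powR_mulrn.
Qed.

Lemma Lfun2_measurable f : f \in Lfun mu 2%:E -> measurable_fun setT f.
Proof. by move/Lfun2P => []. Qed.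

Lemma Lfun2D f g : f \in Lfun mu 2%:E -> g \in Lfun mu 2%:E ->
  (fun x => f x + g x) \in Lfun mu 2%:E.
Proof.
by have [_ H] := Lfun_addr_closed mu (lee1n 2 : (1 <= 2%:E)%E); exact: H.
Qed.

Lemma Lfun2Z (r : R) f : f \in Lfun mu 2%:E -> (fun x => r * f x) \in Lfun mu 2%:E.
Proof.
move=> f2; rewrite (_ : (fun x => _) = r \o* f).
  by apply: Lfun_scale => //; rewrite ler1n.
by apply/funext => x /=; rewrite mulrC.
Qed.

Lemma Lfun2_cst (r : R) : (fun=> r) \in Lfun mu 2%:E.
Proof. exact: Lfun_cst. Qed.

Lemma Lfun2_sum (I : finType) (F : I -> T -> R) :
  (forall i, F i \in Lfun mu 2%:E) -> (fun x => \sum_i F i x) \in Lfun mu 2%:E.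
Proof.
move=> F2; elim: (index_enum I) => [|i s IH].
  by under eq_fun do rewrite big_nil; exact: Lfun2_cst.
by under eq_fun do rewrite big_cons; exact: Lfun2D.
Qed.

Lemma Lfun2_integrable f : f \in Lfun mu 2%:E -> mu.-integrable setT (EFin \o f).
Proof.
move=> f2; apply/Lfun1_integrable; apply: Lfun_subset12 => //.
by rewrite fin_num_measure.
Qed.

Lemma Lfun2_integrableM f g : f \in Lfun mu 2%:E -> g \in Lfun mu 2%:E ->
  mu.-integrable setT (EFin \o (fun x => f x * g x)).
Proof. by move=> f2 g2; apply/Lfun1_integrable; exact: Lfun2_mul_Lfun1. Qed.

Lemma Rintegral_prob_cst (r : R) : \int[mu]_x r = r.
Proof.
rewrite Rintegral_cst// [X in fine X](_ : _ = 1%E) ?mulr1//.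
exact: probability_setT.
Qed.

Lemma Rintegral_sum (I : finType) (F : I -> T -> R) :
  (forall i, mu.-integrable setT (EFin \o F i)) ->
  \int[mu]_x (\sum_i F i x) = \sum_i \int[mu]_x F i x.
Proof.
move=> iF; rewrite /Rintegral.
transitivity (fine (\int[mu]_x (\sum_i (F i x)%:E))%E).
  by congr fine; apply: eq_integral => x _; rewrite sumEFin.
rewrite (integral_sum measurableT iF) sum_fine// => i _.
exact: (integrable_fin_num measurableT (iF i)).
Qed.

Lemma Pythagoras_sum (J : finType) (Z : J -> T -> R) :
  (forall j, Z j \in Lfun mu 2%:E) ->
  (forall j k, j != k -> \int[mu]_x (Z j x * Z k x) = 0) ->
  \int[mu]_x ((\sum_j Z j x) ^+ 2) = \sum_j \int[mu]_x (Z j x ^+ 2).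
Proof.
move=> Z2 Zo.
transitivity (\int[mu]_x (\sum_j (\sum_k Z j x * Z k x))).
  by apply: eq_Rintegral => x _; rewrite expr2 big_distrlr.
rewrite Rintegral_sum => [|j]; last first.
  under eq_fun do rewrite -mulr_sumr.
  by apply: Lfun2_integrableM => //; exact: Lfun2_sum.
apply: eq_bigr => j _; rewrite Rintegral_sum => [|k]; last exact: Lfun2_integrableM.
rewrite (bigD1 j)//= big1 ?addr0 => [|k kj]; last by rewrite Zo// eq_sym.
by apply: eq_Rintegral => x _; rewrite expr2.
Qed.

End SquareIntegrable.

(** * Orthogonal decomposition of order two *)

Section Chaos.
Context {R : realType} {dX : measure_display} {X : measurableType dX}
  {dO : measure_display} {Omega : measurableType dO} {P : probability Omega R}
  {I : finType} {Y : I -> Omega -> X} {D : I -> probability X R}.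
Hypotheses (lawY : forall k, has_law P (Y k) (D k))
  (indY : mutually_independent P Y).

Lemma measurable_prod_in (S : {set I}) (h : I -> X -> R) :
  (forall k, measurable_fun setT (h k)) ->
  measurable_fun setT (fun w => \prod_(k in S) h k (Y k w)).
Proof.
move=> mh; under eq_fun do rewrite big_mkcond/=.
apply: (@measurable_prod _ _ _ _ _ _ (fun k w => if k \in S then h k (Y k w) else 1)).
move=> k _; case: (k \in S) => //.
by case: (lawY k) => mY _; exact: (measurableT_comp (mh k)).
Qed.

Lemma integrable_prod_in (S : {set I}) (h : I -> X -> R) :
  (forall k, (D k).-integrable setT (EFin \o h k)) ->
  P.-integrable setT (EFin \o (fun w => \prod_(k in S) h k (Y k w))).
Proof.
(* Padding with the constant 1 outside [S] reduces the restricted product to a product over all of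
   [I]. *)
move=> ih; pose h1 k x : R := if k \in S then h k x else 1.
have ih1 k : (D k).-integrable setT (EFin \o h1 k).
  rewrite /h1; case: (k \in S) => //.
  exact: Lfun2_integrable (Lfun2_cst 1).
have := integrable_prod lawY indY _ ih1.
rewrite (_ : (fun w => _) = (fun w => \prod_(k in S) h k (Y k w)))//.
by apply/funext => w; rewrite [RHS]big_mkcond; apply: eq_bigr => k _; rewrite /h1.
Qed.

Lemma Rintegral_prod_in (S : {set I}) (h : I -> X -> R) :
  (forall k, (D k).-integrable setT (EFin \o h k)) ->
  \int[P]_w (\prod_(k in S) h k (Y k w)) = \prod_(k in S) \int[D k]_x h k x.
Proof.
move=> ih; pose h1 k x : R := if k \in S then h k x else 1.
have ih1 k : (D k).-integrable setT (EFin \o h1 k).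
  rewrite /h1; case: (k \in S) => //.
  exact: Lfun2_integrable (Lfun2_cst 1).
transitivity (\int[P]_w (\prod_k h1 k (Y k w))).
  by apply: eq_Rintegral => w _; rewrite big_mkcond; apply: eq_bigr.
rewrite (Rintegral_prod lawY indY _ ih1) [RHS]big_mkcond; apply: eq_bigr => k _.
rewrite /h1; case: (k \in S) => //.
exact: Rintegral_prob_cst.
Qed.

(** The square of the product is the product of the squares, whose integrability follows from
    independence; second moments of the single factors therefore suffice, however many factors there
    are. *)
Lemma Lfun2_prod_in (S : {set I}) (h : I -> X -> R) :
  (forall k, h k \in Lfun (D k) 2%:E) ->
  (fun w => \prod_(k in S) h k (Y k w)) \in Lfun P 2%:E.
Proof.
move=> h2; apply/Lfun2P; split.
  by apply: measurable_prod_in => k; exact: Lfun2_measurable (h2 k).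
under eq_fun do rewrite /= -prodrXl.
by apply: (integrable_prod_in S (fun k x => h k x ^+ 2)) => k; exact: Lfun2_integrable_sqr.
Qed.

(* Some k lies in exactly one of S and S', and then the k-th factor of the
   expectation of the product is the vanishing mean of h k or h' k. *)
Lemma prod_in_orthogonal (S S' : {set I}) (h h' : I -> X -> R) :
  (forall k, h k \in Lfun (D k) 2%:E) -> (forall k, h' k \in Lfun (D k) 2%:E) ->
  (forall k, \int[D k]_x h k x = 0) -> (forall k, \int[D k]_x h' k x = 0) ->
  S != S' ->
  \int[P]_w ((\prod_(k in S) h k (Y k w)) * (\prod_(k in S') h' k (Y k w))) = 0.
Proof.
move=> h2 h'2 h0 h'0 SS'.
pose res (A : {set I}) (u : I -> X -> R) k x : R := if k \in A then u k x else 1.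
have res2 A u k : u k \in Lfun (D k) 2%:E -> res A u k \in Lfun (D k) 2%:E.
  by rewrite /res; case: (k \in A) => // _; exact: Lfun2_cst.
transitivity (\int[P]_w (\prod_k (res S h k (Y k w) * res S' h' k (Y k w)))).
  by apply: eq_Rintegral => w _; rewrite big_split/= big_mkcond [X in _ * X]big_mkcond.
rewrite (Rintegral_prod lawY indY
  (fun k x => res S h k x * res S' h' k x)); last first.
  by move=> k; apply: Lfun2_integrableM; exact: res2.
have [k kSS'] : exists k, (k \in S) != (k \in S').
  apply/existsP; apply: contraNT SS' => /existsPn H.
  by apply/eqP/setP => k; apply/eqP; rewrite -[_ == _]negbK H.
rewrite (bigD1 k)//= (_ : \int[D k]_x _ = 0) ?mul0r// /res.
case: (k \in S) (k \in S') kSS' => -[]// _.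
  by rewrite -[RHS](h0 k); apply: eq_Rintegral => x _; rewrite mulr1.
by rewrite -[RHS](h'0 k); apply: eq_Rintegral => x _; rewrite mul1r.
Qed.


Lemma sum_prod_in_orthogonal (A B : finType) (S S' : {set I})
    (h : A -> I -> X -> R) (h' : B -> I -> X -> R) :
  (forall a k, h a k \in Lfun (D k) 2%:E) ->
  (forall b k, h' b k \in Lfun (D k) 2%:E) ->
  (forall a k, \int[D k]_x h a k x = 0) ->
  (forall b k, \int[D k]_x h' b k x = 0) ->
  S != S' ->
  \int[P]_w ((\sum_a \prod_(k in S) h a k (Y k w)) *
             (\sum_b \prod_(k in S') h' b k (Y k w))) = 0.
Proof.
move=> h2 h'2 h0 h'0 SS'.
transitivity (\int[P]_w (\sum_a \sum_b
    (\prod_(k in S) h a k (Y k w)) * (\prod_(k in S') h' b k (Y k w)))).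
  by apply: eq_Rintegral => w _; rewrite big_distrlr.
rewrite Rintegral_sum => [|a]; last first.
  under eq_fun do rewrite -mulr_sumr.
  apply: Lfun2_integrableM; first exact: Lfun2_prod_in.
  by apply: Lfun2_sum => b; exact: Lfun2_prod_in.
apply: big1 => a _; rewrite Rintegral_sum => [|b]; last first.
  by apply: Lfun2_integrableM; exact: Lfun2_prod_in.
by apply: big1 => b _; exact: prod_in_orthogonal.
Qed.

Lemma prod_set2 (F : I -> R) (k l : I) : k != l ->
  \prod_(r in [set k; l]%SET) F r = F k * F l.
Proof. by move=> kl; rewrite big_setU1 ?inE//= big_set1. Qed.

(** The pairs [(k, l)] and [(l, k)] carry the same interaction, so they are not orthogonal to each
    other. Ordering by [enum_rank] keeps one representative of each unordered pair, with weight
    2. *)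
Lemma sum_offdiag_sym (a : I -> I -> R) : (forall k l, a k l = a l k) ->
  \sum_k \sum_(l | l != k) a k l =
  \sum_k \sum_l (if (enum_rank k < enum_rank l)%N then 2 * a k l else 0).
Proof.
move=> asym.
pose b k l : R := if (enum_rank k < enum_rank l)%N then a k l else 0.
transitivity (\sum_k \sum_l (b k l + b l k)).
  apply: eq_bigr => k _; rewrite big_mkcond; apply: eq_bigr => l _; rewrite /b.
  rewrite -(inj_eq enum_rank_inj) -(inj_eq val_inj)/= (asym l k).
  by case: ltngtP; rewrite ?addr0 ?add0r.
under eq_bigr do rewrite big_split/=.
rewrite big_split/= [X in _ + X]exchange_big/=.
transitivity (2 * \sum_k \sum_l b k l); first by rewrite mulr_natl mulr2n.
rewrite mulr_sumr.
apply: eq_bigr => k _; rewrite mulr_sumr; apply: eq_bigr => l _.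
by rewrite /b; case: ifP => _; rewrite ?mulr0.
Qed.

(** * Variance of a second-order form in independent samples *)

Section SecondOrder.
Context {n : nat} (phi : I -> X -> R) (g : 'I_n -> I -> X -> R)
  (q : I -> I -> R).
Hypotheses (phi2 : forall k, phi k \in Lfun (D k) 2%:E)
  (phi0 : forall k, \int[D k]_x phi k x = 0)
  (g2 : forall a k, g a k \in Lfun (D k) 2%:E)
  (g0 : forall a k, \int[D k]_x g a k x = 0)
  (qsym : forall k l, q k l = q l k).

Let v k := \int[D k]_x (\sum_a g a k x ^+ 2).

(** Cauchy-Schwarz holds pointwise in the coordinates [a]; independence then factors the expectation
    of the product of the two squared norms. *)
Lemma sqr_inner_le (k l : I) : k != l ->
  \int[P]_w ((\sum_a g a k (Y k w) * g a l (Y l w)) ^+ 2) <= v k * v l.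
Proof.
move=> kl; pose N r x := \sum_a g a r x ^+ 2.
have iN r : (D r).-integrable setT (EFin \o N r).
  rewrite (_ : EFin \o N r = (fun x => \sum_a (g a r x ^+ 2)%:E)%E); last first.
    by apply/funext => x /=; rewrite sumEFin.
  by apply: integrable_sum => // a _; exact: Lfun2_integrable_sqr.
rewrite -(@prod_set2 v)// -(Rintegral_prod_in _ N)//.
have E w : \sum_a g a k (Y k w) * g a l (Y l w) =
    \sum_a \prod_(r in [set k; l]%SET) g a r (Y r w).
  by apply: eq_bigr => a _; rewrite (prod_set2 (fun r => g a r (Y r w))).
apply: le_Rintegral => //.
- under eq_fun do rewrite E; apply: Lfun2_integrable_sqr.
  by apply: Lfun2_sum => a; exact: Lfun2_prod_in.
- exact: integrable_prod_in.
- move=> w _; rewrite (prod_set2 (fun r => N r (Y r w)))//.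
  exact: Cauchy_Schwarz_sum.
Qed.

Let lt_rank (k l : I) := (enum_rank k < enum_rank l)%N.

Let lt_rank_neq k l : lt_rank k l -> k != l.
Proof. by rewrite /lt_rank; apply: contraTneq => ->; rewrite ltnn. Qed.

(** Orthogonal family behind the second-order form. Diagonal and wrongly ordered pairs are set to
    zero, so distinct nonzero members live on distinct index sets. The one-term sum over [a < 1]
    gives singletons the shape expected by [sum_prod_in_orthogonal]. *)
Let Z (j : I + I * I) w : R := match j with
  | inl k => \sum_(a < 1) \prod_(r in [set k]%SET) phi r (Y r w)
  | inr (k, l) => (if lt_rank k l then 2 * q k l else 0) *
      \sum_a \prod_(r in [set k; l]%SET) g a r (Y r w)
  end.

Let Z2 j : Z j \in Lfun P 2%:E.
Proof.
case: j => [k|[k l]]; rewrite /Z.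
  by apply: Lfun2_sum => a; exact: Lfun2_prod_in.
by apply: Lfun2Z; apply: Lfun2_sum => a; exact: Lfun2_prod_in.
Qed.

Let Z_orthogonal j j' : j != j' -> \int[P]_w (Z j w * Z j' w) = 0.
Proof.
have scale (c : R) (F G : Omega -> R) : F \in Lfun P 2%:E -> G \in Lfun P 2%:E ->
    \int[P]_w (F w * G w) = 0 -> \int[P]_w ((c * F w) * G w) = 0.
  move=> F2 G2 FG; transitivity (\int[P]_w (c * (F w * G w))).
    by apply: eq_Rintegral => w _; rewrite mulrA.
  by rewrite RintegralZl ?FG ?mulr0//; exact: Lfun2_integrableM.
have comm (F G : Omega -> R) : \int[P]_w (F w * G w) = 0 -> \int[P]_w (G w * F w) = 0.
  by move=> <-; apply: eq_Rintegral => w _; rewrite mulrC.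
have Zk k : (fun w => \sum_(a < 1) \prod_(r in [set k]%SET) phi r (Y r w)) \in Lfun P 2%:E.
  exact: (Z2 (inl k)).
have Gkl k l : (fun w => \sum_a \prod_(r in [set k; l]%SET) g a r (Y r w)) \in Lfun P 2%:E.
  by apply: Lfun2_sum => a; exact: Lfun2_prod_in.
have neq12 (k k' l : I) : k' != l -> [set k'; l]%SET != [set k]%SET.
  move=> kl; apply/eqP => e; have := cards2 k' l.
  by rewrite e cards1 kl.
case: j j' => [k|[k l]] [k'|[k' l']] jj'.
- rewrite /Z.
  apply: (sum_prod_in_orthogonal _ _ _ _ (fun _ : 'I_1 => phi)
    (fun _ : 'I_1 => phi)) => //.
  apply: contra_neq jj' => /setP/(_ k); rewrite !inE eqxx => /esym/eqP ->//.
- apply: comm; rewrite /Z; case: ifPn => [kl|_]; last first.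
    by under eq_Rintegral do rewrite !mul0r; exact: Rintegral_prob_cst.
  apply: (scale _ _ _) => //.
  apply: (sum_prod_in_orthogonal _ _ _ _ g (fun _ : 'I_1 => phi)) => //.
  by apply: neq12; exact: lt_rank_neq.
- rewrite /Z; case: ifPn => [kl|_]; last first.
    by under eq_Rintegral do rewrite !mul0r; exact: Rintegral_prob_cst.
  apply: (scale _ _ _) => //.
  apply: (sum_prod_in_orthogonal _ _ _ _ g (fun _ : 'I_1 => phi)) => //.
  by apply: neq12; exact: lt_rank_neq.
- rewrite /Z; case: ifPn => [kl|_]; last first.
    by under eq_Rintegral do rewrite !mul0r; exact: Rintegral_prob_cst.
  apply: (scale _ _ _) => //; first exact: (Z2 (inr (k', l'))).
  apply: comm; rewrite /Z; case: ifPn => [kl'|_]; last first.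
    by under eq_Rintegral do rewrite !mul0r; exact: Rintegral_prob_cst.
  apply: (scale _ _ _) => //; apply: (sum_prod_in_orthogonal _ _ _ _ g g) => //.
  apply: contra_neq jj' => /setP e.
  have : l \in [set k'; l']%SET by rewrite e !inE eqxx orbT.
  have : k \in [set k'; l']%SET by rewrite e !inE eqxx.
  (* Two pairs with the same underlying set are equal or swapped; the swap and the degenerate cases
     contradict the strict rank order. *)
  rewrite !inE => /orP[] /eqP ek /orP[] /eqP el; subst.
  + by move: kl; rewrite /lt_rank ltnn.
  + by [].
  + by move: (ltn_trans kl kl'); rewrite ltnn.
  + by move: kl; rewrite /lt_rank ltnn.
Qed.

Let ZE w : \sum_k phi k (Y k w) + \sum_k \sum_(l | l != k)
    q k l * (\sum_a g a k (Y k w) * g a l (Y l w)) = \sum_j Z j w.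
Proof.
rewrite big_sumType/=; congr (_ + _).
  by apply: eq_bigr => k _; rewrite big_ord1 big_set1.
rewrite sum_offdiag_sym => [|k l]; last first.
  by rewrite qsym; congr (_ * _); apply: eq_bigr => a _; rewrite mulrC.
rewrite pair_bigA; apply: eq_bigr => -[k l] _ /=; rewrite -/(lt_rank k l).
case: ifPn => kl; last by rewrite mul0r.
rewrite mulrA; congr (_ * _); apply: eq_bigr => a _.
by rewrite (prod_set2 (fun r => g a r (Y r w)))//; exact: lt_rank_neq.
Qed.

Lemma Lfun2_second_order :
  (fun w => \sum_k phi k (Y k w) + \sum_k \sum_(l | l != k)
      q k l * \sum_a g a k (Y k w) * g a l (Y l w)) \in Lfun P 2%:E.
Proof. by under eq_fun do rewrite ZE; exact: Lfun2_sum. Qed.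

(** By Pythagoras over [Z], the one-sample terms contribute exactly; the only loss is the
    Cauchy-Schwarz bound on each interaction. *)
Lemma second_order_variance_le :
  \int[P]_w ((\sum_k phi k (Y k w) + \sum_k \sum_(l | l != k)
      q k l * \sum_a g a k (Y k w) * g a l (Y l w)) ^+ 2)
  <= \sum_k \int[D k]_x (phi k x ^+ 2) +
     2 * \sum_k \sum_(l | l != k) q k l ^+ 2 * (v k * v l).
Proof.
under eq_Rintegral do rewrite ZE.
rewrite Pythagoras_sum// big_sumType/= lerD//.
  apply: ler_sum => k _; rewrite le_eqVlt; apply/orP; left; apply/eqP.
  transitivity (\int[P]_w (\prod_(r in [set k]%SET) phi r (Y r w) ^+ 2)).
    by apply: eq_Rintegral => w _; rewrite big_ord1 !big_set1.
  rewrite (Rintegral_prod_in _ (fun r x => phi r x ^+ 2)) ?big_set1// => r.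
  exact: Lfun2_integrable_sqr.
rewrite mulr_sumr.
under [leRHS]eq_bigr do rewrite mulr_sumr.
rewrite sum_offdiag_sym => [|k l]; last by rewrite qsym [v k * _]mulrC.
rewrite pair_bigA; apply: ler_sum => -[k l] _ /=; rewrite -/(lt_rank k l).
case: ifPn => kl; last first.
  by under eq_Rintegral do rewrite mul0r expr0n; rewrite Rintegral_prob_cst.
under eq_Rintegral do rewrite exprMn.
rewrite RintegralZl//; last first.
  by apply: Lfun2_integrable_sqr; apply: Lfun2_sum => a; exact: Lfun2_prod_in.
(* One factor 2 is that of the statement, the other comes from folding ordered pairs; together they
   match the square of the doubled coefficient in [Z]. *)
rewrite (_ : 2 * (2 * _) = (2 * q k l) ^+ 2 * (v k * v l)); last by ring.
rewrite ler_wpM2l ?sqr_ge0//.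
have /sqr_inner_le := lt_rank_neq _ _ kl.
apply: le_trans; rewrite le_eqVlt; apply/orP; left; apply/eqP.
apply: eq_Rintegral => w _; congr (_ ^+ 2); apply: eq_bigr => a _.
by rewrite (prod_set2 (fun r => g a r (Y r w)))//; exact: lt_rank_neq.
Qed.

End SecondOrder.
End Chaos.

(** * Moments of a class *)

Section ClassMoments.
Context {R : realType} {dX : measure_display} {X : measurableType dX} {d : nat}
  {D : probability X R} {f : X -> 'rV[R]_d}.
Hypotheses (mf : forall a : 'I_d, measurable_fun setT (fun x => f x 0 a))
  (f4 : D.-integrable setT (fun x => (sqnorm (f x) ^+ 2)%:E)).

Let g (a : 'I_d) x := f x 0 a - feat_mean D f 0 a.
Let N x := \sum_a g a x ^+ 2.

Let sqnorm_f2 : (fun x => sqnorm (f x)) \in Lfun D 2%:E.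
Proof.
apply/Lfun2P; split => //; apply: measurable_sum => a.
exact: measurable_funX.
Qed.

Let f2 a : (fun x => f x 0 a) \in Lfun D 2%:E.
Proof.
apply/Lfun2P; split => //.
apply: (le_integrable measurableT _ _ (Lfun2_integrable _ sqnorm_f2)) => //.
  by apply/measurable_EFinP; exact: measurable_funX.
move=> x _ /=; rewrite lee_fin !ger0_norm ?sqr_ge0//; last first.
  by apply: sumr_ge0 => b _; exact: sqr_ge0.
by rewrite /sqnorm (bigD1 a)//= lerDl sumr_ge0// => b _; exact: sqr_ge0.
Qed.

Lemma Lfun2_centered a : g a \in Lfun D 2%:E.
Proof. by apply: Lfun2D => //; exact: Lfun2_cst. Qed.

Lemma Rintegral_centered a : \int[D]_x g a x = 0.
Proof.
rewrite RintegralB//; [|exact: (Lfun2_integrable _ (f2 a))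
  |exact: (Lfun2_integrable _ (Lfun2_cst _))].
by rewrite Rintegral_prob_cst mxE subrr.
Qed.

(** [N] differs from [sqnorm (f x)] by an affine function of the coordinates, so no fourth power has
    to be expanded. *)
Lemma Lfun2_sqr_centered : N \in Lfun D 2%:E.
Proof.
pose mu := feat_mean D f.
rewrite (_ : N = fun x => sqnorm (f x) + (\sum_a (- 2 * mu 0 a) * f x 0 a + sqnorm mu)).
  apply: Lfun2D => //; apply: Lfun2D; last exact: Lfun2_cst.
  by apply: Lfun2_sum => a; exact: Lfun2Z.
apply/funext => x; rewrite /N /sqnorm -!big_split/=; apply: eq_bigr => a _.
by rewrite /g -/mu; ring.
Qed.

Lemma Rintegral_sqr_centered : \int[D]_x N x = feat_tvar D f.
Proof.
rewrite Rintegral_sum => [|a]; last exact: Lfun2_integrable_sqr (Lfun2_centered a).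
by apply: eq_bigr => a _; rewrite mxE; apply: eq_Rintegral => x _; rewrite expr2.
Qed.

Lemma feat_tvar_ge0 : 0 <= feat_tvar D f.
Proof.
rewrite -Rintegral_sqr_centered; apply: Rintegral_ge0 => x _.
by apply: sumr_ge0 => a _; exact: sqr_ge0.
Qed.

Lemma feat_M4E : feat_M4 D f = \int[D]_x (N x ^+ 2).
Proof.
apply: eq_Rintegral => x _; congr (_ ^+ 2); apply: eq_bigr => a _.
by rewrite /g !mxE.
Qed.

Let v := feat_tvar D f.

Lemma Lfun2_fluctuation : (fun x => N x - v) \in Lfun D 2%:E.
Proof. by apply: Lfun2D; [exact: Lfun2_sqr_centered|exact: Lfun2_cst]. Qed.

Lemma Rintegral_fluctuation : \int[D]_x (N x - v) = 0.
Proof.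
rewrite RintegralB//; [|exact: (Lfun2_integrable _ Lfun2_sqr_centered)
  |exact: (Lfun2_integrable _ (Lfun2_cst _))].
by rewrite Rintegral_prob_cst Rintegral_sqr_centered subrr.
Qed.

(** A variance is at most the second moment; the discarded term is [v ^+ 2]. *)
Lemma Rintegral_sqr_fluctuation_le : \int[D]_x ((N x - v) ^+ 2) <= feat_M4 D f.
Proof.
have N2 := Lfun2_sqr_centered.
rewrite (_ : \int[D]_x _ = \int[D]_x (N x ^+ 2 + ((- 2 * v) * N x + v ^+ 2))); last first.
  by apply: eq_Rintegral => x _; ring.
rewrite RintegralD//; [|exact: Lfun2_integrable_sqr|]; last first.
  by apply: Lfun2_integrable; apply: Lfun2D; [exact: Lfun2Z|exact: Lfun2_cst].
rewrite RintegralD//; [|exact: (Lfun2_integrable _ (Lfun2Z _ _ N2))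
  |exact: (Lfun2_integrable _ (Lfun2_cst _))].
rewrite RintegralZl//; last exact: Lfun2_integrable.
rewrite Rintegral_prob_cst Rintegral_sqr_centered -feat_M4E -/v.
have := sqr_ge0 v; lra.
Qed.

Variable u : 'rV[R]_d.

Lemma Lfun2_direction : (fun x => \sum_a u 0 a * g a x) \in Lfun D 2%:E.
Proof. by apply: Lfun2_sum => a; apply: Lfun2Z; exact: Lfun2_centered. Qed.

Lemma Rintegral_direction : \int[D]_x (\sum_a u 0 a * g a x) = 0.
Proof.
rewrite Rintegral_sum => [|a]; last first.
  exact: (Lfun2_integrable _ (Lfun2Z _ _ (Lfun2_centered a))).
apply: big1 => a _; rewrite RintegralZl//; last exact: (Lfun2_integrable _ (Lfun2_centered a)).
by rewrite Rintegral_centered mulr0.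
Qed.

Lemma Rintegral_sqr_direction :
  \int[D]_x ((\sum_a u 0 a * g a x) ^+ 2) = (u *m feat_cov D f *m u^T) 0 0.
Proof.
transitivity (\int[D]_x (\sum_a \sum_b (u 0 a * g a x) * (u 0 b * g b x))).
  by apply: eq_Rintegral => x _; rewrite expr2 big_distrlr.
have ug2 a : (fun x => u 0 a * g a x) \in Lfun D 2%:E.
  by apply: Lfun2Z; exact: Lfun2_centered.
rewrite Rintegral_sum => [|a]; last first.
  under eq_fun do rewrite -mulr_sumr.
  by apply: Lfun2_integrableM => //; exact: Lfun2_sum.
rewrite mxE.
transitivity (\sum_a \sum_b u 0 a * feat_cov D f a b * u 0 b); last first.
  rewrite exchange_big; apply: eq_bigr => b _.
  by rewrite !mxE mulr_suml.
apply: eq_bigr => a _; rewrite Rintegral_sum => [|b]; last exact: Lfun2_integrableM.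
apply: eq_bigr => b _; rewrite mxE mulrAC -RintegralZl//; last first.
  by apply: Lfun2_integrableM; exact: Lfun2_centered.
by apply: eq_Rintegral => x _; rewrite /g; ring.
Qed.

Lemma Rintegral_sqr_direction_le :
  \int[D]_x ((\sum_a u 0 a * g a x) ^+ 2) <= sqnorm u * v.
Proof.
rewrite /v -Rintegral_sqr_centered -RintegralZl//; last first.
  exact: (Lfun2_integrable _ Lfun2_sqr_centered).
apply: le_Rintegral => //.
- exact: Lfun2_integrable_sqr Lfun2_direction.
- exact: (Lfun2_integrable _ (Lfun2Z _ _ Lfun2_sqr_centered)).
- by move=> x _; exact: Cauchy_Schwarz_sum.
Qed.

(* [(s + t)^2 <= 3/2 s^2 + 3 t^2], the weights that produce the constants 6 and
   3 of the theorem. *)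
Lemma Rintegral_sqr_direction_fluctuation_le (alpha beta : R) :
  \int[D]_x ((alpha * (\sum_a u 0 a * g a x) + beta * (N x - v)) ^+ 2) <=
  3 / 2 * alpha ^+ 2 * (sqnorm u * v) + 3 * beta ^+ 2 * feat_M4 D f.
Proof.
have L2 := Lfun2_direction; have F2 := Lfun2_fluctuation.
pose L x := \sum_a u 0 a * g a x; pose F x := N x - v.
apply: (@le_trans _ _ (\int[D]_x ((3 / 2 * alpha ^+ 2) * L x ^+ 2 +
    (3 * beta ^+ 2) * F x ^+ 2))).
  have iL : D.-integrable setT (EFin \o (fun x => (3 / 2 * alpha ^+ 2) * L x ^+ 2)).
    exact: (integrableZl measurableT (3 / 2 * alpha ^+ 2) (Lfun2_integrable_sqr L2)).
  have iF : D.-integrable setT (EFin \o (fun x => (3 * beta ^+ 2) * F x ^+ 2)).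
    exact: (integrableZl measurableT (3 * beta ^+ 2) (Lfun2_integrable_sqr F2)).
  apply: le_Rintegral => //.
  - by apply: Lfun2_integrable_sqr; apply: Lfun2D; exact: Lfun2Z.
  - exact: (integrableD measurableT iL iF).
  - move=> x _; rewrite -/(L x) -/(F x).
    (* With [s = alpha * L x] and [t = beta * F x], the gap is half of [(s - 2 * t) ^+ 2]. *)
    have := sqr_ge0 (alpha * L x - 2 * (beta * F x)); nra.
rewrite RintegralD//; last 2 first.
- exact: (integrableZl measurableT (3 / 2 * alpha ^+ 2) (Lfun2_integrable_sqr L2)).
- exact: (integrableZl measurableT (3 * beta ^+ 2) (Lfun2_integrable_sqr F2)).
rewrite !RintegralZl//; [|exact: Lfun2_integrable_sqr|exact: Lfun2_integrable_sqr].
apply: lerD; apply: ler_wpM2l.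
- by rewrite mulr_ge0 ?sqr_ge0// divr_ge0.
- exact: Rintegral_sqr_direction_le.
- by rewrite mulr_ge0 ?sqr_ge0.
- exact: Rintegral_sqr_fluctuation_le.
Qed.

End ClassMoments.

(** * The margin between two classes *)

Lemma big_option (V : nmodType) (J : finType) (F : option J -> V) :
  \sum_k F k = F None + \sum_j F (Some j).
Proof.
rewrite (bigD1 None)//=; congr (_ + _).
rewrite (reindex_omap Some id)/=; last by case.
by apply: eq_bigl => j; rewrite eqxx.
Qed.

(** * Coefficients of the samples in the residuals and in the margin *)

Section Samples.
Context {R : realFieldType} {C m : nat}.
Variables i j : 'I_C.
Hypotheses (ij : j != i) (m0 : (0 < m)%N).
Local Notation idx := (option ('I_C * 'I_m)).

(** [None] is the test point and [Some (c, s)] a support point. The sums over samples below collapse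
    through this to rational expressions in [m], which [field] settles. *)
Lemma sum_samples (F : idx -> R) (A : 'I_C -> R) :
  (forall c s, F (Some (c, s)) = A c) ->
  (forall c, c != i -> c != j -> A c = 0) ->
  \sum_k F k = F None + m%:R * (A i + A j).
Proof.
move=> FA A0; rewrite big_option; congr (_ + _).
transitivity (\sum_(c < C) \sum_(s < m) A c).
  by rewrite pair_bigA; apply: eq_bigr => -[c s] _; rewrite FA.
under eq_bigr do rewrite sumr_const card_ord -mulr_natl.
rewrite -mulr_sumr (bigD1 i)//= (bigD1 j)//= big1 ?addr0// => c /andP[ci cj].
exact: A0.
Qed.

(* coefficient of the k-th sample in  z - (empirical centroid of class c) *)
Definition residual_coef (c : 'I_C) (k : idx) : R :=
  if k is Some (c', _) then (if c' == c then - m%:R^-1 else 0) else 1.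

(** Matrix of the margin as a quadratic form in the samples. *)
Definition margin_coef (k l : idx) : R :=
  residual_coef j k * residual_coef j l - residual_coef i k * residual_coef i l.

Definition class_of (k : idx) : 'I_C := if k is Some (c, _) then c else i.

Let mn0 : m%:R != 0 :> R. Proof. by rewrite pnatr_eq0 -lt0n. Qed.
Let ji : (i == j) = false. Proof. by rewrite eq_sym (negPf ij). Qed.

Lemma sum_residual_coef_mean (mu : 'I_C -> R) (c : 'I_C) : (c == i) || (c == j) ->
  \sum_k residual_coef c k * mu (class_of k) = mu i - mu c.
Proof.
move=> cij; rewrite (sum_samples _ (fun c' => (if c' == c then - m%:R^-1 else 0) * mu c'))//=.
  by case/orP: cij => /eqP ->; rewrite ?eqxx ?ji ?(negPf ij); field.
move=> c' ci cj; case: eqP => [e|_]; rewrite ?mul0r//.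
by move: cij; rewrite -e (negPf ci) (negPf cj).
Qed.

(** The test point cancels between the two residuals, and each of the [m] support points of class
    [j] or [i] weighs plus or minus [1 / m ^ 2]. The result is the bias of the mean margin. *)
Lemma sum_margin_coef_diag (v : 'I_C -> R) :
  \sum_k margin_coef k k * v (class_of k) = (v j - v i) / m%:R.
Proof.
rewrite (sum_samples _ (fun c => (((c == j)%:R - (c == i)%:R) / m%:R ^+ 2) * v c))/=.
- by rewrite /margin_coef/= !eqxx ji (negPf ij)/=; field.
- move=> c s; rewrite /margin_coef/=; congr (_ * _).
  by do 2 (case: eqP => _ /=); field.
- by move=> c /negPf -> /negPf ->; rewrite subrr !mul0r.
Qed.

(** Pairs of the test point with a support point of class [i] or [j] have squared coefficient
    [1 / m ^ 2] and occur in both orders: this is the first term. Pairs inside one class have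
    [1 / m ^ 4] and number [m (m - 1)] per class: this is the second. Pairs across classes have
    coefficient 0. *)
Lemma sum_margin_coef_offdiag (v : 'I_C -> R) :
  \sum_k \sum_(l | l != k) margin_coef k l ^+ 2 * (v (class_of k) * v (class_of l)) =
  2 * (v i * (v i + v j)) / m%:R + (m%:R - 1) / m%:R ^+ 3 * (v i ^+ 2 + v j ^+ 2).
Proof.
pose F k l := margin_coef k l ^+ 2 * (v (class_of k) * v (class_of l)).
(* Numerical indicators make the coefficients polynomial; idempotence and [I c * J c = 0] then
   replace case analysis. *)
pose I c : R := (c == i)%:R; pose J c : R := (c == j)%:R.
have IJ c : I c * J c = 0.
  rewrite /I /J; case: eqP => [->|_]; last by rewrite mul0r.
  by rewrite ji mulr0.
have bb (b : bool) : b%:R * b%:R = b%:R :> R by case: b; rewrite ?mulr1 ?mulr0.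
have II c : I c * I c = I c by exact: bb.
have JJ c : J c * J c = J c by exact: bb.
have rc c c' s : residual_coef c (Some (c', s)) = - (c' == c)%:R / m%:R.
  by rewrite /=; case: eqP => _; rewrite ?mulN1r// oppr0 mul0r.
have FNS c s : F None (Some (c, s)) = (J c + I c) / m%:R ^+ 2 * (v i * v c).
  rewrite /F /margin_coef !rc /= -/(I c) -/(J c) !mul1r; congr (_ * _).
  rewrite (_ : _ ^+ 2 = (J c * J c - 2 * (I c * J c) + I c * I c) / m%:R ^+ 2).
    by rewrite IJ II JJ; field.
  by field.
have FSS c s c' s' : F (Some (c, s)) (Some (c', s')) =
    (J c * J c' + I c * I c') / m%:R ^+ 4 * (v c * v c').
  rewrite /F /margin_coef !rc -/(I c) -/(J c) -/(I c') -/(J c'); congr (_ * _).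
  rewrite (_ : _ ^+ 2 = ((J c * J c) * (J c' * J c') - 2 * (I c * J c) * (I c' * J c') +
     (I c * I c) * (I c' * I c')) / m%:R ^+ 4).
    by rewrite !IJ !II !JJ; field.
  by field.
have FNN : F None None = 0 by rewrite /F /margin_coef/= subrr expr0n mul0r.
have FC k l : F k l = F l k.
  by rewrite /F /margin_coef [v _ * _]mulrC; congr (_ ^+ 2 * _); ring.
have Iv : [/\ I i = 1, I j = 0, J i = 0 & J j = 1].
  by rewrite /I /J !eqxx ji (negPf ij).
case: Iv => Ii Ij Ji Jj.
have I0 c : c != i -> I c = 0 by move=> /negPf ci; rewrite /I ci.
have J0 c : c != j -> J c = 0 by move=> /negPf ci; rewrite /J ci.
have rowN : \sum_l F None l = v i * (v i + v j) / m%:R.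
  rewrite (sum_samples _ (fun c => (J c + I c) / m%:R ^+ 2 * (v i * v c)))//.
    by rewrite FNN Ii Ij Ji Jj; field.
  by move=> c ci cj; rewrite I0// J0// addr0 !mul0r.
have rowS c s : \sum_l F (Some (c, s)) l = (J c + I c) / m%:R ^+ 2 * (v i * v c) +
    (I c * v i + J c * v j) / m%:R ^+ 3 * v c.
  rewrite (sum_samples _ (fun c' => (J c * J c' + I c * I c') / m%:R ^+ 4 * (v c * v c')))//.
    by rewrite FC FNS Ii Ij Ji Jj; field.
  by move=> c' ci cj; rewrite (I0 c')// (J0 c')// !mulr0 addr0 !mul0r.
transitivity (\sum_k (\sum_l F k l - F k k)).
  by apply: eq_bigr => k _; rewrite [in RHS](bigD1 k)//= addrAC subrr add0r.
rewrite (sum_samples _ (fun c => (J c + I c) / m%:R ^+ 2 * (v i * v c) +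
    (I c * v i + J c * v j) / m%:R ^+ 3 * v c -
    (J c * J c + I c * I c) / m%:R ^+ 4 * (v c * v c))).
- by rewrite rowN FNN Ii Ij Ji Jj; field.
- by move=> c s; rewrite rowS FSS.
- by move=> c ci cj; rewrite (I0 c)// (J0 c)// !mul0r addr0 !mul0r; ring.
Qed.

End Samples.

(* The three summands on the right are the mean, the one-sample terms and the
   interactions when the g a k are centered and v k is the variance of g ^~ k. *)
Lemma sqr_diff_expansion (R : comPzRingType) (I A : finType)
    (D : A -> R) (p r v : I -> R) (g : A -> I -> R) :
  \sum_a (- D a + \sum_k p k * g a k) ^+ 2 - \sum_a (\sum_k r k * g a k) ^+ 2 =
  \sum_a D a ^+ 2 + \sum_k (p k * p k - r k * r k) * v k +
  (\sum_k (- 2 * p k * (\sum_a D a * g a k) +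
           (p k * p k - r k * r k) * (\sum_a g a k ^+ 2 - v k)) +
   \sum_k \sum_(l | l != k) (p k * p l - r k * r l) * \sum_a g a k * g a l).
Proof.
pose w k l := p k * p l - r k * r l.
(* The diagonal involves one sample at a time, so it joins the linear part; [v] is merely added and
   subtracted there. *)
have split_diag : \sum_k \sum_l w k l * (\sum_a g a k * g a l) =
    \sum_k w k k * (\sum_a g a k ^+ 2) +
    \sum_k \sum_(l | l != k) w k l * (\sum_a g a k * g a l).
  by rewrite -big_split; apply: eq_bigr => k _; rewrite (bigD1 k).
have quad : \sum_k \sum_l w k l * (\sum_a g a k * g a l) =
    \sum_a (\sum_k p k * g a k) ^+ 2 - \sum_a (\sum_k r k * g a k) ^+ 2.
  transitivity (\sum_a \sum_k \sum_l w k l * (g a k * g a l)).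
    rewrite [RHS]exchange_big/=; apply: eq_bigr => k _.
    by rewrite [RHS]exchange_big/=; apply: eq_bigr => l _; rewrite mulr_sumr.
  rewrite -sumrB; apply: eq_bigr => a _.
  rewrite !expr2 !big_distrlr/= -sumrB; apply: eq_bigr => k _.
  by rewrite -sumrB; apply: eq_bigr => l _; rewrite /w/=; ring.
have lin : \sum_k (- 2 * p k * (\sum_a D a * g a k)) =
    \sum_a (- 2 * D a * (\sum_k p k * g a k)).
  under eq_bigr do rewrite mulr_sumr.
  under [RHS]eq_bigr do rewrite mulr_sumr.
  by rewrite exchange_big; apply: eq_bigr => a _; apply: eq_bigr => k _ /=; ring.
transitivity (\sum_a D a ^+ 2 + \sum_a (- 2 * D a * (\sum_k p k * g a k)) +
    (\sum_a (\sum_k p k * g a k) ^+ 2 - \sum_a (\sum_k r k * g a k) ^+ 2)).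
  rewrite addrA -!big_split/=; congr (_ - _).
  by apply: eq_bigr => a _; ring.
rewrite -quad split_diag -lin big_split/=.
under [X in _ = _ + (_ + X + _)]eq_bigr do rewrite mulrBr.
rewrite sumrB -/w; ring.
Qed.

Lemma sqnorm_ge0 (R : realType) (d : nat) (u : 'rV[R]_d) : 0 <= sqnorm u.
Proof. by apply: sumr_ge0 => a _; exact: sqr_ge0. Qed.

Lemma sqnorm_eq0 (R : realType) (d : nat) (u : 'rV[R]_d) :
  (sqnorm u == 0) = (u == 0).
Proof.
rewrite /sqnorm psumr_eq0; last by move=> a _; rewrite sqr_ge0.
apply/allP/eqP => [u0|-> a _]; last by rewrite mxE expr0n eqxx.
apply/rowP => a; rewrite mxE; have := u0 a (mem_index_enum a).
by rewrite sqrf_eq0 => /eqP.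
Qed.

(** * Mean and variance of the margin *)

Section Margin.
Context {R : realType} {dX : measure_display} {X : measurableType dX}
  {dO : measure_display} {Omega : measurableType dO} {P : probability Omega R}
  {d C m : nat}.
Hypothesis m0 : (0 < m)%N.
Context {f : X -> 'rV[R]_d} {D : 'I_C -> probability X R}.
Hypotheses (mf : forall a : 'I_d, measurable_fun setT (fun x => f x 0 a))
  (f4 : forall c, (D c).-integrable setT (fun x => (sqnorm (f x) ^+ 2)%:E)).
Context {xs : 'I_C -> 'I_m -> Omega -> X} {xt : 'I_C -> Omega -> X}.
Hypotheses (hxs : forall c s, has_law P (xs c s) (D c))
  (hxt : forall i, has_law P (xt i) (D i))
  (hind : forall i, mutually_independent P (test_and_support xs xt i)).
Variables i j : 'I_C.
Hypotheses (ij : j != i) (mu_neq : mu_ D f i != mu_ D f j).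

Local Notation idx := (option ('I_C * 'I_m)).
Let Y := test_and_support xs xt i.
Let cls : idx -> 'I_C := class_of i.
Let Dk (k : idx) := D (cls k).
Let Delta := mu_ D f j - mu_ D f i.
Let v c := feat_tvar (D c) f.
Let M c := feat_M4 (D c) f.
Let g (a : 'I_d) (k : idx) x := f x 0 a - mu_ D f (cls k) 0 a.
Let p (k : idx) : R := residual_coef j k.
Let q (k l : idx) : R := margin_coef i j k l.
(** One-sample term: a linear part along [Delta] plus the centered diagonal of the quadratic form.
    At the test point the diagonal coefficient is 0, so only the linear part remains. *)
Let phi (k : idx) x := (- 2 * p k) * (\sum_a Delta 0 a * g a k x) +
  q k k * (\sum_a g a k x ^+ 2 - v (cls k)).
Let d2 := dist_ D f i j ^+ 2.

Definition margin (w : Omega) : R :=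
  sqnorm (f (xt i w) - emp_centroids f xs w j) -
  sqnorm (f (xt i w) - emp_centroids f xs w i).

(** Expectation of [margin]: an empirical centroid of class [c] has mean squared deviation
    [v c / m]. *)
Definition mean_margin : R := d2 + (v j - v i) / m%:R.

Let lawY k : has_law P (Y k) (Dk k).
Proof. by case: k => [[c s]|]; [exact: hxs|exact: hxt]. Qed.

Lemma dist_sqr : d2 = sqnorm Delta.
Proof. by rewrite /d2 sqr_sqrtr// sqnorm_ge0. Qed.

Lemma dist_sqr_gt0 : 0 < d2.
Proof.
by rewrite dist_sqr lt_def sqnorm_ge0 andbT sqnorm_eq0 subr_eq0 eq_sym.
Qed.

Let residualE c w a : (f (xt i w) - emp_centroids f xs w c) 0 a =
  \sum_k residual_coef c k * f (Y k w) 0 a.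
Proof.
rewrite big_option/= mul1r !mxE summxE; congr (_ + _).
transitivity (\sum_(c' < C) \sum_(s < m)
    (if c' == c then - m%:R^-1 else 0) * f (xs c' s w) 0 a).
  rewrite (bigD1 c)//= eqxx [X in _ + X]big1 ?addr0 => [|c' /negPf c'c]; last first.
    by apply: big1 => s _; rewrite c'c mul0r.
  by rewrite -mulr_sumr mulNr.
by rewrite pair_bigA; apply: eq_bigr => -[].
Qed.

Let residual_centeredE c w a : (c == i) || (c == j) ->
  \sum_k residual_coef c k * f (Y k w) 0 a =
  mu_ D f i 0 a - mu_ D f c 0 a + \sum_k residual_coef c k * g a k (Y k w).
Proof.
move=> cij; rewrite -(sum_residual_coef_mean i j ij m0 (fun c => mu_ D f c 0 a))//.
by rewrite -big_split; apply: eq_bigr => k _ /=; rewrite /g /cls; ring.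
Qed.

(** Instance of [sqr_diff_expansion]: the residual to centroid [j] has mean [- Delta], the residual
    to centroid [i] has mean zero. *)
Lemma margin_expansion w : margin w - mean_margin =
  \sum_k phi k (Y k w) + \sum_k \sum_(l | l != k)
    q k l * \sum_a g a k (Y k w) * g a l (Y l w).
Proof.
have -> : margin w =
    \sum_a (- Delta 0 a + \sum_k p k * g a k (Y k w)) ^+ 2 -
    \sum_a (\sum_k residual_coef i k * g a k (Y k w)) ^+ 2.
  rewrite /margin /sqnorm; congr (_ - _); apply: eq_bigr => a _; rewrite residualE.
    by rewrite residual_centeredE ?eqxx ?orbT// /Delta !mxE opprB.
  by rewrite residual_centeredE ?eqxx// subrr add0r.
rewrite (sqr_diff_expansion _ _ _ _ _ _ (fun k => v (cls k)) (fun a k => g a k (Y k w))).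
rewrite (sum_margin_coef_diag i j ij m0 v) /mean_margin dist_sqr.
by rewrite addrC addKr.
Qed.

Let phi2 k : phi k \in Lfun (Dk k) 2%:E.
Proof.
apply: Lfun2D; apply: Lfun2Z.
  exact: (Lfun2_direction (mf) (f4 _)).
exact: (Lfun2_fluctuation (mf) (f4 _)).
Qed.

Let phi0 k : \int[Dk k]_x phi k x = 0.
Proof.
have L2 := Lfun2_direction mf (f4 (cls k)) Delta.
have F2 := Lfun2_fluctuation mf (f4 (cls k)).
rewrite RintegralD//; last 2 first.
- exact: (Lfun2_integrable _ (Lfun2Z _ _ L2)).
- exact: (Lfun2_integrable _ (Lfun2Z _ _ F2)).
rewrite !RintegralZl//; [|exact: (Lfun2_integrable _ L2)|exact: (Lfun2_integrable _ F2)].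
rewrite (Rintegral_direction mf (f4 (cls k))) (Rintegral_fluctuation mf (f4 (cls k))).
by rewrite !mulr0 addr0.
Qed.

Let g2 a k : g a k \in Lfun (Dk k) 2%:E.
Proof. exact: (Lfun2_centered mf (f4 _)). Qed.

Let g0 a k : \int[Dk k]_x g a k x = 0.
Proof. exact: (Rintegral_centered mf (f4 _)). Qed.

Let qsym k l : q k l = q l k.
Proof. by rewrite /q /margin_coef; ring. Qed.

Lemma Lfun2_margin : (fun w => margin w - mean_margin) \in Lfun P 2%:E.
Proof.
rewrite (_ : (fun w => _) = (fun w => \sum_k phi k (Y k w) + \sum_k \sum_(l | l != k)
    q k l * \sum_a g a k (Y k w) * g a l (Y l w))); last first.
  by apply/funext => w; exact: margin_expansion.
exact: (Lfun2_second_order lawY (hind i) phi g q phi2 g2 qsym).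
Qed.

Let S := (Delta *m feat_cov (D i) f *m Delta^T) 0 0.

Let v_ge0 c : 0 <= v c. Proof. exact: (feat_tvar_ge0 mf (f4 c)). Qed.

(** The test point contributes [4 * S] exactly, the support points give the [M] terms and part of
    the [d2] term, and the interactions are absorbed by the [(v i + v j) ^+ 2] terms. *)
Lemma margin_variance_le :
  \int[P]_w ((margin w - mean_margin) ^+ 2) <=
  4 * S + 12 / m%:R * (v i + v j) ^+ 2 + 6 / m%:R * (v i + v j) * d2 +
  3 / m%:R ^+ 3 * (M i + M j + 2 * (m%:R - 1) * (v i + v j) ^+ 2).
Proof.
under eq_Rintegral do rewrite margin_expansion.
have H := second_order_variance_le lawY (hind i) phi g q phi2 phi0 g2 g0 qsym.
apply: (le_trans H) => {H}.
have mR : 1 <= m%:R :> R by rewrite ler1n.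
have vE k : \int[Dk k]_x (\sum_a g a k x ^+ 2) = v (cls k).
  exact: (Rintegral_sqr_centered mf (f4 _)).
under [X in _ + 2 * X]eq_bigr do under eq_bigr do rewrite !vE.
rewrite (sum_margin_coef_offdiag i j ij m0 v).
(* [A c] bounds the second moment of [phi] at one support point of class [c]. For class [j] the
   weights are [2 / m] and [1 / m ^ 2]; for class [i] the linear weight vanishes; other classes do
   not enter the margin. *)
pose A c : R := (if c == j then 6 / m%:R ^+ 2 * d2 * v j + 3 / m%:R ^+ 4 * M j else 0) +
  (if c == i then 3 / m%:R ^+ 4 * M i else 0).
pose B (k : idx) : R := if k is Some (c, _) then A c else 4 * S.
have ji : (i == j) = false by rewrite eq_sym (negPf ij).
have SB : \sum_k B k = 4 * S + m%:R * (A i + A j).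
  rewrite (sum_samples i j ij _ A)// => c /negPf ci /negPf cj.
  by rewrite /A ci cj addr0.
have phiB k : \int[Dk k]_x (phi k x ^+ 2) <= B k.
  case: k => [[c s]|]; rewrite /B.
    apply: (le_trans (Rintegral_sqr_direction_fluctuation_le mf (f4 c) Delta _ _)).
    rewrite /p /q /margin_coef/= -dist_sqr -/(M c) -/(v c) /A.
    have [->|cj] := eqVneq c j.
      rewrite (negPf ij) addr0 le_eqVlt; apply/orP; left; apply/eqP.
      by field; rewrite pnatr_eq0 -lt0n.
    have [->|ci] := eqVneq c i; rewrite le_eqVlt; apply/orP; left; apply/eqP.
      by field; rewrite pnatr_eq0 -lt0n.
    by ring.
  rewrite le_eqVlt; apply/orP; left; apply/eqP.
  rewrite /S -(Rintegral_sqr_direction mf (f4 i)) -RintegralZl//; last first.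
    exact: (Lfun2_integrable_sqr (Lfun2_direction mf (f4 i) Delta)).
  apply: eq_Rintegral => x _; rewrite /phi /p /q /margin_coef/=.
  by rewrite /g/=; ring.
apply: (@le_trans _ _ (4 * S + m%:R * (A i + A j) + 2 * (2 * (v i * (v i + v j)) / m%:R +
    (m%:R - 1) / m%:R ^+ 3 * (v i ^+ 2 + v j ^+ 2)))).
  by rewrite lerD2r -SB; apply: ler_sum => k _; exact: phiB.
rewrite /A !eqxx ji (negPf ij) add0r addr0.
rewrite -subr_ge0.
set r := m%:R in mR *; have r0 : r != 0 by rewrite gt_eqF// (lt_le_trans ltr01).
(* The slack splits into two fractions with nonnegative numerators; the second uses [1 <= m]. *)
rewrite (_ : _ - _ = (4 * (v i + v j) * (2 * v i + 3 * v j) + 6 * v i * d2) / r +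
   (4 * (v i * v i + 3 * (v i * v j) + v j * v j) * (r - 1)) / r ^+ 3); last by field.
have [vi0 vj0] := (v_ge0 i, v_ge0 j); have r_ge0 : 0 <= r by rewrite (le_trans ler01).
have rB1 : 0 <= r - 1 by rewrite subr_ge0.
have d2_ge0 : 0 <= d2 by exact: sqr_ge0.
have [ii jj] := (mulr_ge0 vi0 vi0, mulr_ge0 vj0 vj0).
have [iv id] := (mulr_ge0 vi0 vj0, mulr_ge0 vi0 d2_ge0).
apply: addr_ge0; apply: divr_ge0; rewrite ?exprn_ge0//; first by nra.
by rewrite mulr_ge0//; nra.
Qed.

End Margin.

(** * Union and Chebyshev bounds over the competing classes *)

Theorem theorem2
  (R : realType) (dX : measure_display) (X : measurableType dX)
  (dO : measure_display) (Omega : measurableType dO) (P : probability Omega R)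
  (d C m : nat) (hC : (2 <= C)%N) (hm : (1 <= m)%N)
  (f : X -> 'rV[R]_d) (D : 'I_C -> probability X R)
  (hf : forall k : 'I_d, measurable_fun setT (fun x => f x 0 k))
  (hM4 : forall c : 'I_C, (D c).-integrable setT (fun x => (sqnorm (f x) ^+ 2)%:E))
  (hdist : forall i j : 'I_C, i != j -> mu_ D f i != mu_ D f j)
  (hpos : forall i j : 'I_C, i != j ->
     0 < dist_ D f i j ^+ 2 + (feat_tvar (D j) f - feat_tvar (D i) f) / m%:R)
  (xs : 'I_C -> 'I_m -> Omega -> X) (xt : 'I_C -> Omega -> X)
  (hxs : forall c s, has_law P (xs c s) (D c))
  (hxt : forall i, has_law P (xt i) (D i))
  (hind : forall i, mutually_independent P (test_and_support xs xt i))
  (pred : 'rV[R]_d -> ('I_C -> 'rV[R]_d) -> 'I_C) (hpred : ncc_rule pred)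
  (hmeas : forall i, measurable (ncc_err_event pred f xs xt i)) :
  let v := fun c => feat_tvar (D c) f in
  let den := fun i j => (1 + (v j - v i) / (m%:R * dist_ D f i j ^+ 2)) ^+ 2 in
  ncc_err P pred f xs xt <=
    (C%:R)^-1 * \sum_(i < C) \sum_(j < C | j != i)
      (4 * Vt_ D f i j + 12 / m%:R * V_ D f i j ^+ 2 + 6 / m%:R * V_ D f i j) / den i j
  + (C%:R)^-1 * \sum_(i < C) \sum_(j < C | j != i)
      (3 / m%:R ^+ 3 * (Theta_ D f i j + 2 * (m%:R - 1) * V_ D f i j ^+ 2)) / den i j.
Proof.
cbv beta zeta.
pose den i j : R := (1 + (feat_tvar (D j) f - feat_tvar (D i) f) /
  (m%:R * dist_ D f i j ^+ 2)) ^+ 2.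
have m0 : (0 < m)%N by [].
have mR : m%:R != 0 :> R by rewrite pnatr_eq0 -lt0n.
rewrite /ncc_err -mulrDr ler_wpM2l ?invr_ge0// -big_split/=.
apply: ler_sum => i _; rewrite -big_split/=.
pose T j w := margin (f := f) (xs := xs) (xt := xt) i j w.
pose kappa j := mean_margin (m := m) (f := f) (D := D) i j.
have kappa_gt0 j : j != i -> 0 < kappa j.
  by move=> ij; rewrite /kappa /mean_margin hpos// eq_sym.
have T2 j : j != i -> (fun w => T j w - kappa j) \in Lfun P 2%:E.
  by move=> ij; exact: (Lfun2_margin m0 hf hM4 hxs hxt hind i j ij).
(* Chebyshev majorant for class [j]; the value 0 at [j = i] lets the sum range over all classes. *)
pose H j w : R := if j != i then (T j w - kappa j) ^+ 2 / kappa j ^+ 2 else 0.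
have iH j : P.-integrable setT (EFin \o H j).
  rewrite /H; have [ij|_] := boolP (j != i); last exact: (Lfun2_integrable _ (Lfun2_cst 0)).
  under eq_fun do rewrite mulrC.
  exact: (integrableZl measurableT (kappa j ^+ 2)^-1 (Lfun2_integrable_sqr (T2 j ij))).
pose E := ncc_err_event pred f xs xt i.
have -> : fine (P E) = \int[P]_w \1_E w.
  by rewrite /Rintegral (integral_indic P measurableT (hmeas i)) setIT.
(* On an error, the predicted class j has T j <= 0, so the j-th term alone is
   at least 1: this is the union and Chebyshev bounds in one pointwise step. *)
apply: (@le_trans _ _ (\int[P]_w (\sum_j H j w))).
  apply: le_Rintegral => //.
  - exact: (integrable_indic P (hmeas i)).
  - rewrite (_ : EFin \o _ = (fun w => \sum_j (H j w)%:E)%E); last first.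
      by apply/funext => w /=; rewrite sumEFin.
    by apply: integrable_sum => // j _; exact: iH.
  - move=> w _.
    have H0 j : 0 <= H j w.
      by rewrite /H; case: ifP => _ //; rewrite divr_ge0 ?sqr_ge0.
    rewrite indicE; have [wE|wE] := boolP (w \in E); last by rewrite sumr_ge0.
    move: wE; rewrite inE /E /ncc_err_event /=.
    set j := pred _ _ => ji.
    have H1 : 1 <= H j w.
      rewrite /H ji ler_pdivlMr ?exprn_gt0 ?kappa_gt0// mul1r.
      have Tj : T j w <= 0 by rewrite /T /margin subr_le0; exact: hpred.
      have := kappa_gt0 j ji; nra.
    by apply: (le_trans H1); rewrite (bigD1 j)//= lerDl sumr_ge0.
rewrite Rintegral_sum// [leRHS]big_mkcond; apply: ler_sum => j _.
rewrite /H; case: ifPn => [ij|_]; last by rewrite Rintegral_prob_cst.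
have d2_gt0 : 0 < dist_ D f i j ^+ 2.
  by apply: dist_sqr_gt0; rewrite // hdist// eq_sym.
rewrite RintegralZr//; last exact: (Lfun2_integrable_sqr (T2 j ij)).
have := margin_variance_le m0 hf hM4 hxs hxt hind i j ij.
rewrite -/(T j) -/(kappa j).
set S := (_ *m _ *m _) 0 0 => var_le.
set e := dist_ D f i j ^+ 2 in d2_gt0 var_le.
have e0 : e != 0 by rewrite gt_eqF.
have dist0 : dist_ D f i j != 0 by rewrite -sqrf_eq0.
(* [u_] is normalized, while [S] uses the raw difference of means, hence two further powers of the
   distance. *)
have VtE : Vt_ D f i j = S / e ^+ 2.
  rewrite /Vt_ /u_ linearZ/= -!scalemxAl -scalemxAr scalerA mxE -/S /e.
  by field.
have k0 : kappa j != 0 by rewrite gt_eqF// kappa_gt0.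
(* Dividing by [kappa j ^+ 2] amounts to dividing by [den i j] once the numerator is scaled by
   [e ^+ 2]; the variance bound then becomes the claimed summand with equality. *)
have denE : den i j = (kappa j / e) ^+ 2.
  rewrite /den /kappa /mean_margin -/e; congr (_ ^+ 2); field.
  by rewrite e0 mR.
rewrite -[leRHS]mulrDl -/(den i j) denE VtE /V_ /Theta_.
rewrite (exprM _ 2 2) -/e ler_pdivrMr ?exprn_gt0 ?kappa_gt0//.
apply: (le_trans var_le); rewrite le_eqVlt; apply/orP; left; apply/eqP.
by field; rewrite k0 e0 mR.
Qed.
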